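(* Let $\eta\ge 1$ and let $d_1,\ldots,d_\eta\ge 2$ be integers. Let $J=\prod_{i=1}^\eta\{1,\ldots,d_i\}$ and $$\mathscr{S}=\Big\{\prod_{i=1}^\eta\{k_i,k_i+1\}: k\in\prod_{i=1}^\eta\{1,\ldots,d_i-1\}\Big\},$$ and let $G^c_{\mathscr{S}}$ be the conflict graph of $\mathscr{S}$. If for each $i\in\{1,\ldots,\eta\}$ we have a biclique cover $\{(\tilde A^{i,j},\tilde B^{i,j})\}_{j=1}^{t_i}$ of the conflict graph of SOS2$(d_i)$, then a biclique cover of $G^c_{\mathscr{S}}$ of depth $\sum_{i=1}^\eta t_i$ is given by $\bigcup_{i=1}^\eta\{(A^{i,j},B^{i,j})\}_{j=1}^{t_i}$, where $$A^{i,j}=\{x\in J:x_i\in\tilde A^{i,j}\},\qquad B^{i,j}=\{x\in J:x_i\in\tilde B^{i,j}\}.$$ In particular, if for each $i$, $\{h^{i,j}\}_{j=1}^{d_i-1}\subseteq\{0,1\}^{\lceil\log_2(d_i-1)\rceil}$ is a Gray code, and $h^{i,0}:=h^{i,1}$, $h^{i,d_i}:=h^{i,d_i-1}$, then a biclique cover of $G^c_{\mathscr{S}}$ of depth $\sum_{i=1}^\eta\lceil\log_2(d_i-1)\rceil$ is given by $$\hat A^{i,j}=\{x\in J:h^{i,x_i-1}_j=h^{i,x_i}_j=0\},\qquad \hat B^{i,j}=\{x\in J:h^{i,x_i-1}_j=h^{i,x_i}_j=1\}$$ for $i\in\{1,\ldots,\eta\}$ and $j\in\{1,\ldots,\lc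eil\log_2(d_i-1)\rceil\}$.
   Context: For a family $\mathscr{S}$ of subsets of a finite set $J$, a set $T\subseteq J$ is infeasible if it is contained in no $S\in\mathscr{S}$. The conflict graph of $\mathscr{S}$ is $G^c_{\mathscr{S}}=(J,\bar E)$ with $\bar E$ the set of infeasible two-element subsets of $J$. SOS2$(N)$ is the family $\{\{\tau,\tau+1\}:1\le\tau\le N-1\}$ on ground set $\{1,\ldots,N\}$. A biclique cover of depth $t$ of a graph $G=(J,E)$ is a family $\{(A^j,B^j)\}_{j=1}^t$ with $\emptyset\subsetneq A^j,B^j\subsetneq J$, $A^j\cap B^j=\emptyset$, and $\bigcup_{j=1}^t A^j*B^j=E$, where $A*B=\{\{a,b\}:a\in A,\ b\in B\}$. A Gray code is a sequence of distinct binary vectors in which each pair of consecutive vectors differs in exactly one component; $h_j$ denotes the $j$-th component of $h$. *)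

(* Defs.v *)
From mathcomp Require Import all_boot.

Set Implicit Arguments.
Unset Strict Implicit.
Unset Printing Implicit Defensive.

Definition infeasible (J : finType) (F : {set {set J}}) (T : {set J}) : bool :=
  ~~ [exists S in F, T \subset S].

(* A simple graph (J, E) is represented by its edge set E, a set of two-element
   subsets of the vertex type J. *)
Definition conflict_graph (J : finType) (F : {set {set J}}) : {set {set J}} :=
  [set e : {set J} | (#|e| == 2) && infeasible F e].

Definition biclique (J : finType) (A B : {set J}) : {set {set J}} :=
  [set [set a; b] | a in A, b in B].

(* The family of t pairs is indexed by an arbitrary finite type K with t
   elements, so that the disjoint union of families can be indexed by a sigma
   type. *)
Definition biclique_cover (J : finType) (E : {set {set J}}) (t : nat)
    (K : finType) (A B : K -> {set J}) : Prop :=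
  [/\ #|K| = t,
      forall k, [/\ set0 \proper A k, A k \proper [set: J],
                    set0 \proper B k & B k \proper [set: J]],
      forall k, A k :&: B k = set0
    & \bigcup_(k : K) biclique (A k) (B k) = E].

(* The ground set {1, ..., N} is 'I_N, where u : 'I_N stands for u + 1;
   likewise k : 'I_N.-1 stands for k + 1 in {1, ..., N - 1}. *)
Definition consecutive (N : nat) (k : 'I_N.-1) : {set 'I_N} :=
  [set u : 'I_N | (u == k :> nat) || (u == k.+1 :> nat)].

Definition SOS2 (N : nat) : {set {set 'I_N}} :=
  [set consecutive k | k : 'I_N.-1].

Definition grid (eta : nat) (d : 'I_eta -> nat) : finType :=
  {dffun forall i : 'I_eta, 'I_(d i)}.

Definition grid_cells (eta : nat) (d : 'I_eta -> nat) : {set {set grid d}} :=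
  [set setXn (fun i => consecutive (k i))
     | k : {dffun forall i : 'I_eta, 'I_(d i).-1}].

Definition gray_code (L : nat) (s : seq (L.-tuple bool)) : bool :=
  uniq s &&
  sorted (fun u v => #|[set j : 'I_L | tnth u j != tnth v j]| == 1) s.

(* Main.v *)
(* Two grid points lie in a common cell iff in every coordinate they lie in a
   common SOS2 segment, so conflict edges of the grid are exactly the pairs that
   conflict in some coordinate, and covers of the factors pull back to a cover.
   For Gray codes, attach to the point u the segment {h u, h u.+1}, a subcube of
   dimension at most 1. Points at distance at least 2 have disjoint segments,
   and disjoint subcubes are separated by some bit. Each side of each biclique
   is nonempty since the code has minimal length, so no bit is constant. *)
Require Import Defs.
From mathcomp Require Import all_boot.
From mathcomp Require Import zify.

(** * Bicliques and conflict graphs, tested on pairs of points *)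

Lemma mem_biclique (J : finType) (A B : {set J}) (x y : J) :
  ([set x; y] \in biclique A B) =
  ((x \in A) && (y \in B)) || ((y \in A) && (x \in B)).
Proof.
apply/imset2P/orP => [[a b aA bB exy]|[]/andP[xA yB]]; last 2 first.
- by exists x y.
- by exists y x => //; rewrite setUC.
have: x \in [set a; b] by rewrite -exy set21.
have: y \in [set a; b] by rewrite -exy set22.
have: a \in [set x; y] by rewrite exy set21.
have: b \in [set x; y] by rewrite exy set22.
rewrite !inE => /orP[]/eqP eb /orP[]/eqP ea /orP[]/eqP ey /orP[]/eqP ex; subst;
  by rewrite ?aA ?bB; auto.
Qed.

Lemma mem_conflict_graph (J : finType) (F : {set {set J}}) (x y : J) :
  ([set x; y] \in conflict_graph F) = (x != y) && infeasible F [set x; y].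
Proof. by rewrite inE cards2 eqSS eqb1. Qed.

(** Disjointness of the sides makes every biclique edge a genuine two-element set, so the two edge
    sets need only be compared on pairs of distinct points. *)
Lemma biclique_cover_conflictP (J K : finType) (F : {set {set J}})
    (A B : K -> {set J}) (disjAB : forall k, A k :&: B k = set0) :
  \bigcup_(k : K) biclique (A k) (B k) = conflict_graph F <->
  forall x y, x != y ->
    (exists k, [set x; y] \in biclique (A k) (B k)) <->
    infeasible F [set x; y].
Proof.
split=> [eqF x y xy | eqF].
  have /setP/(_ [set x; y]) := eqF.
  rewrite mem_conflict_graph xy /= => <-.
  by split=> [[k kP]|/bigcupP[k _ kP]]; [apply/bigcupP; exists k | exists k].
apply/setP=> e; apply/bigcupP/idP => [[k _ ek]|].
  have /imset2P[a b aA bB ee] := ek; rewrite ee mem_conflict_graph.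
  have ab : a != b.
    apply/eqP=> eab; have := in_set0 a.
    by rewrite -(disjAB k) inE aA eab bB.
  by rewrite ab; apply/eqF => //; exists k; rewrite -ee.
rewrite inE => /andP[/cards2P[x [y [xy ->]]]] /(eqF _ _ xy)[k kP].
by exists k.
Qed.

Lemma eq_biclique_cover (J K : finType) (E : {set {set J}}) (t : nat)
    (A B A' B' : K -> {set J}) :
  A =1 A' -> B =1 B' -> biclique_cover E t A B -> biclique_cover E t A' B'.
Proof.
move=> eA eB [cK proper_AB disjAB cover_AB]; split=> //.
- by move=> k; rewrite -eA -eB.
- by move=> k; rewrite -eA -eB.
by rewrite -cover_AB; apply: eq_bigr => k _; rewrite -eA -eB.
Qed.

(** * Conflicts in a path and in a grid *)

Lemma infeasible_SOS2 (N : nat) (u v : 'I_N) : 2 <= N ->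
  infeasible (SOS2 N) [set u; v] = (u.+1 < v) || (v.+1 < u).
Proof.
move=> N2; apply/negP/idP => [noS|uv].
  apply/negP=> /negP uv; apply: noS.
  (* The segment starts at the smaller point, capped at [N.-2]: if [u] and [v] are both the last
     point, only the segment ending there contains them. *)
  have ltk : minn (minn u v) N.-2 < N.-1 by lia.
  apply/exists_inP; exists (consecutive (Ordinal ltk)); first exact: imset_f.
  have uN := ltn_ord u; have vN := ltn_ord v.
  by apply/subsetP=> w /set2P[]->; rewrite inE /=; lia.
case/exists_inP => _ /imsetP[k _ ->] /subsetP sub.
have := sub u (set21 _ _); have := sub v (set22 _ _); rewrite !inE; lia.
Qed.

(** A cell is a product of segments chosen independently in each coordinate, so feasible coordinates
    assemble into one cell. *)
Lemma infeasible_grid_cells (eta : nat) (d : 'I_eta -> nat) (x y : grid d) :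
  infeasible (grid_cells d) [set x; y] =
  [exists i, infeasible (SOS2 (d i)) [set x i; y i]].
Proof.
rewrite -[RHS]negbK negb_exists; congr (~~ _).
apply/exists_inP/forallP => [[_ /imsetP[k _ ->] /subsetP sub] i|].
  rewrite negbK; apply/exists_inP; exists (consecutive (k i)).
    exact: imset_f.
  have := sub x (set21 _ _); have := sub y (set22 _ _).
  rewrite !inE => /familyP/(_ i) yi /familyP/(_ i) xi.
  by apply/subsetP=> w /set2P[]->.
move=> feas.
have cell i : exists k : 'I_(d i).-1, [set x i; y i] \subset consecutive k.
  by have := feas i; rewrite negbK => /exists_inP[_ /imsetP[k _ ->]]; exists k.
pose k : {dffun forall i : 'I_eta, 'I_(d i).-1} := [ffun i => xchoose (cell i)].
exists (setXn (fun i => consecutive (k i))); first exact: imset_f.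
have sub i w : w \in [set x i; y i] -> w \in consecutive (k i).
  by rewrite ffunE; apply/subsetP/(xchooseP (cell i)).
by apply/subsetP=> w /set2P[]->; rewrite inE; apply/familyP=> i;
  apply: sub; rewrite !inE eqxx ?orbT.
Qed.

(** * Pulling covers of the factors back to the grid *)

Lemma grid_coordinate_proper (eta : nat) (d : 'I_eta -> nat)
    (d_gt0 : forall i, 0 < d i) (i : 'I_eta) (S : {set 'I_(d i)}) :
  set0 \proper S -> S \proper [set: 'I_(d i)] ->
  set0 \proper [set x : grid d | x i \in S] /\
  [set x : grid d | x i \in S] \proper [set: grid d].
Proof.
(* A grid point with coordinate [u] at [i] and the first value elsewhere lifts witnesses from the
   factor. *)
pose pt (u : 'I_(d i)) : grid d :=
  [ffun i' => dfwith (fun i' => Ordinal (d_gt0 i')) u i'].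
have ptE u : pt u i = u by rewrite ffunE dfwith_in.
rewrite !properE !sub0set !subsetT /=.
move=> /subsetPn[u uS _] /subsetPn[v _ vS]; split.
- by apply/subsetPn; exists (pt u); rewrite inE ?ptE.
by apply/subsetPn; exists (pt v); rewrite !inE ?ptE.
Qed.

Lemma product_biclique_cover (eta : nat) (d : 'I_eta -> nat)
    (hd : forall i, 2 <= d i) (t : 'I_eta -> nat)
    (At Bt : forall i : 'I_eta, 'I_(t i) -> {set 'I_(d i)}) :
  (forall i,
     biclique_cover (conflict_graph (SOS2 (d i))) (t i) (At i) (Bt i)) ->
  biclique_cover (conflict_graph (grid_cells d)) (\sum_(i < eta) t i)
    (fun p : {i : 'I_eta & 'I_(t i)} =>
       [set x : grid d | x (tag p) \in At (tag p) (tagged p)])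
    (fun p : {i : 'I_eta & 'I_(t i)} =>
       [set x : grid d | x (tag p) \in Bt (tag p) (tagged p)]).
Proof.
move=> cov.
have d_gt0 i : 0 < d i by exact: ltnW.
have disj (p : {i : 'I_eta & 'I_(t i)}) :
    [set x : grid d | x (tag p) \in At (tag p) (tagged p)] :&:
    [set x : grid d | x (tag p) \in Bt (tag p) (tagged p)] = set0.
  have [_ _ /(_ (tagged p))/setP disj _] := cov (tag p).
  by apply/setP=> x; have := disj (x (tag p)); rewrite !inE.
split=> //.
- rewrite card_tagged sumnE big_map big_enum /=.
  by apply: eq_bigr => i _; rewrite card_ord.
- move=> p; have [_ /(_ (tagged p))[A0 AT B0 BT] _ _] := cov (tag p).
  by have [? ?] := grid_coordinate_proper _ _ d_gt0 _ _ A0 AT;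
     have [? ?] := grid_coordinate_proper _ _ d_gt0 _ _ B0 BT.
apply/biclique_cover_conflictP => // x y _.
(* Distinct grid points may agree at [i]; then both sides fail, the left by disjointness and the
   right because a single point is feasible. *)
have edge i : (exists j, [set x i; y i] \in biclique (At i j) (Bt i j)) <->
              infeasible (SOS2 (d i)) [set x i; y i].
  have [_ _ disji /(biclique_cover_conflictP _ _ _ _ _ disji) eqF] := cov i.
  have [eqxy|/eqF//] := eqVneq (x i) (y i).
  split=> [[j]|]; last by rewrite infeasible_SOS2 // eqxy; lia.
  rewrite mem_biclique eqxy orbb => yAB; have := in_set0 (y i).
  by rewrite -(disji j) inE yAB.
rewrite infeasible_grid_cells; split.
- case=> [[i j]]; rewrite mem_biclique !inE /= => xy.
  by apply/existsP; exists i; apply/edge; exists j; rewrite mem_biclique.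
case/existsP=> i /edge[j]; rewrite mem_biclique => xy.
by exists (Tagged (fun i => 'I_(t i)) j); rewrite mem_biclique !inE.
Qed.

(** * Subcubes and Gray codes *)

Lemma subcube_hamming1 (L : nat) (a a' c : L.-tuple bool) :
  #|[set j : 'I_L | tnth a j != tnth a' j]| <= 1 ->
  (forall j, tnth c j = tnth a j \/ tnth c j = tnth a' j) -> c = a \/ c = a'.
Proof.
move=> /card_le1_eqP near hull.
case: (eqVneq c a) => [|ca]; first by left.
case: (eqVneq c a') => [|ca']; first by right.
have differ (u v : L.-tuple bool) : u != v -> exists j, tnth u j != tnth v j.
  move=> uv; apply/existsP; rewrite -negb_forall.
  by apply: contra uv => /forallP uv; apply/eqP/eq_from_tnth => j; apply/eqP.
(* Since each bit of [c] comes from [a] or [a'], these two differ at both [i] and [j], hence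
   [i = j], where [c] both differs from [a] and agrees with it. *)
have [i ci] := differ _ _ ca; have [j cj] := differ _ _ ca'.
have ei : tnth c i = tnth a' i by case: (hull i) => // e; rewrite e eqxx in ci.
have ej : tnth c j = tnth a j by case: (hull j) => // e; rewrite e eqxx in cj.
have eij : i = j by apply: near; rewrite inE -?ei -?ej // eq_sym.
by rewrite eij ej eqxx in ci.
Qed.

Section GrayCover.

Variables (N L : nat) (h : nat -> L.-tuple bool).
Hypotheses (N2 : 2 <= N) (gray : gray_code [seq h k | k <- iota 1 N.-1]).
(** The guard [0 < L] allows [N = 2] with [L = 0], where the strict bound would read [1 < 1]. *)
Hypothesis L_minimal : 0 < L -> 2 ^ L.-1 < N.-1.
Hypotheses (h0 : h 0 = h 1) (hN : h N = h N.-1).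

Let nth_code k : k < N.-1 -> nth (h 0) [seq h k | k <- iota 1 N.-1] k = h k.+1.
Proof.
by move=> kN; rewrite (nth_map 0) ?size_iota // nth_iota.
Qed.

Lemma gray_inj k l : 0 < k < N -> 0 < l < N -> h k = h l -> k = l.
Proof.
case: k l => [//|k] [//|l] kN lN.
have [/uniqP-/(_ (h 0)) inj _] := andP gray.
rewrite -!nth_code; [|lia|lia] => /inj e; congr _.+1; apply: e;
  rewrite inE size_map size_iota; lia.
Qed.

(** The bound is not an equality because the repeated end codes make the steps at [0] and [N.-1]
    trivial. *)
Lemma gray_step k : k < N ->
  #|[set j : 'I_L | tnth (h k) j != tnth (h k.+1) j]| <= 1.
Proof.
have same a b : a = b -> #|[set j : 'I_L | tnth (h a) j != tnth (h b) j]| <= 1.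
  by move=> ->; rewrite (eq_card0 (A := _)) // => j; rewrite inE eqxx.
move=> kN; have [k0|k_gt0] := posnP k.
  by rewrite k0 h0 (same 1).
have [ek|kN1] := eqVneq k N.-1.
  by rewrite ek prednK ?hN ?(same N.-1) //; lia.
have [_ /(sortedP (h 0)) sorted_h] := andP gray.
have := sorted_h k.-1; rewrite size_map size_iota !nth_code; try lia.
by rewrite !prednK // => /(_ _)/eqP->//; lia.
Qed.

Lemma gray_separated u v : u.+1 < v -> v < N -> exists j b,
  [/\ tnth (h u) j = b, tnth (h u.+1) j = b,
      tnth (h v) j = ~~ b & tnth (h v.+1) j = ~~ b].
Proof.
move=> uv vN.
pose sep j := (tnth (h u) j == tnth (h u.+1) j) &&
              ((tnth (h v) j == ~~ tnth (h u) j) &&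
               (tnth (h v.+1) j == ~~ tnth (h u) j)).
have [/existsP[j /and3P[/eqP e1 /eqP e2 /eqP e3]]|/existsPn noj] :=
  boolP [exists j, sep j].
  by exists j, (tnth (h u) j).
(* If no bit separates the two segments, they have a common point, by choosing
   each bit in the intersection of its ranges over the two segments. *)
pose c := [tuple if tnth (h u) j == tnth (h u.+1) j then tnth (h u) j
                 else tnth (h v) j | j < L].
have cu : c = h u \/ c = h u.+1.
  apply: subcube_hamming1 => [|j]; first by apply: gray_step; lia.
  rewrite tnth_mktuple.
  by case: (tnth (h u) j) (tnth (h u.+1) j) (tnth (h v) j) => [] [] []; auto.
have cv : c = h v \/ c = h v.+1.
  apply: subcube_hamming1 => [|j]; first exact: gray_step.
  have := noj j; rewrite /sep tnth_mktuple.
  by case: (tnth (h u) j) (tnth (h u.+1) j) (tnth (h v) j) (tnth (h v.+1) j)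
    => [] [] [] []; auto.
(* Index [0] is traded for [1], and below [N] for [N.-1], to stay in the range where [h] is
   injective. *)
have [a [a_gt0 aN ca]] : exists a, [/\ 0 < a, a <= u.+1 & c = h a].
  case: cu => ->; last by exists u.+1.
  by have [->|u0] := posnP u; [exists 1 | exists u; split=> //; lia].
have [b [vb bN cb]] : exists b, [/\ v <= b, b < N & c = h b].
  case: cv => ->; first by exists v.
  have [ev|vN'] := eqVneq v.+1 N; last by exists v.+1; split=> //; lia.
  by exists v; split; rewrite // ev hN -ev.
have eab : a = b by apply: gray_inj; [lia | lia | rewrite -ca].
by lia.
Qed.

Lemma gray_bit_surj (j : 'I_L) (b : bool) :
  exists2 k, 0 < k < N & tnth (h k) j = b.
Proof.
have [/existsP[k /eqP kb]|/existsPn nok] :=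
  boolP [exists k : 'I_N.-1, tnth (h k.+1) j == b].
  by exists k.+1 => //; have := ltn_ord k; lia.
(* A constant bit j would leave room for flipping it, doubling the code. *)
pose f (p : 'I_N.-1 * bool) : L.-tuple bool :=
  [tuple tnth (h p.1.+1) i (+) (p.2 && (i == j)) | i < L].
have bitj (k : 'I_N.-1) : tnth (h k.+1) j = ~~ b.
  by have := nok k; case: (tnth _ j) (b) => [] [].
have f_inj : injective f.
  move=> [k e] [l e'] eqf.
  have ee : e = e'.
    have := congr1 (fun w : L.-tuple bool => tnth w j) eqf.
    rewrite !tnth_mktuple /= !bitj eqxx !andbT.
    by case: (b); case: e {eqf}; case: e'.
  rewrite ee in eqf *; congr (_, _); apply/val_inj/succn_inj/gray_inj.
  - by have := ltn_ord k; rewrite /=; lia.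
  - by have := ltn_ord l; rewrite /=; lia.
  apply: eq_from_tnth => i.
  have := congr1 (fun w : L.-tuple bool => tnth w i) eqf.
  by rewrite !tnth_mktuple /= => /addIb.
(* Injectivity gives [2 * N.-1 <= 2 ^ L], against minimality of [L]. *)
have := leq_card f f_inj.
rewrite card_prod card_ord card_tuple card_bool.
have L0 : 0 < L := leq_ltn_trans (leq0n j) (ltn_ord j).
by have := L_minimal L0; rewrite -[in 2 ^ L](prednK L0) expnS; lia.
Qed.

(** Supplies a point on each side of a biclique: taking the value [b] at one code is not enough, as
    a point carries two consecutive codes. *)
Lemma gray_bit_repeated (j : 'I_L) (b : bool) :
  exists2 u, u < N & tnth (h u) j = b /\ tnth (h u.+1) j = b.
Proof.
have [k /andP[k_gt0 kN] kb] := gray_bit_surj j b.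
have [ek|kb'] := tnth (h k.+1) j =P b; first by exists k.
(* Otherwise bit j changes at both steps next to k, so the neighbours agree. *)
exists k.-1; first lia.
rewrite prednK //; split=> //; apply/eqP/negP=> /negP/eqP kb''.
(* The repeated end codes keep [k] away from both ends, so both neighbours are codes of the
   injective range. *)
have k1 : 1 < k by case: k k_gt0 kN kb kb' kb'' => [|[|k]] //=; rewrite h0.
have kN1 : k.+1 < N.
  rewrite ltn_neqAle kN andbT; apply/eqP=> ek.
  by apply: kb'; rewrite ek hN -ek.
have same i l : l < N -> tnth (h l) j != tnth (h l.+1) j -> i != j ->
    tnth (h l) i = tnth (h l.+1) i.
  move=> /gray_step/card_le1_eqP near lj; apply: contraNeq => li.
  by apply/eqP/near; rewrite inE.
suff /gray_inj eqh : h k.-1 = h k.+1 by lia.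
apply: eq_from_tnth => i; have [->|ij] := eqVneq i j.
  by move: kb' kb''; case: (tnth (h k.-1) j) (tnth (h k.+1) j) (b) => [] [] [].
have -> : tnth (h k.-1) i = tnth (h k) i.
  by rewrite (same i k.-1) ?prednK // ?kb; [lia|apply/eqP].
by apply: same; rewrite // kb eq_sym; apply/eqP.
Qed.

Lemma gray_biclique_cover :
  biclique_cover (conflict_graph (SOS2 N)) L
    (fun j : 'I_L => [set u : 'I_N | (tnth (h u) j == false) &&
                                     (tnth (h u.+1) j == false)])
    (fun j : 'I_L => [set u : 'I_N | (tnth (h u) j == true) &&
                                     (tnth (h u.+1) j == true)]).
Proof.
have disj (j : 'I_L) :
    [set u : 'I_N | (tnth (h u) j == false) && (tnth (h u.+1) j == false)] :&:
    [set u : 'I_N | (tnth (h u) j == true) && (tnth (h u.+1) j == true)] = set0.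
  by apply/setP=> u; rewrite !inE; case: (tnth (h u) j); rewrite ?andbF.
split=> //; first exact: card_ord.
- move=> j.
  (* A point on one side also witnesses that the other side is proper. *)
  have [u uN [uj u'j]] := gray_bit_repeated j false.
  have [v vN [vj v'j]] := gray_bit_repeated j true.
  rewrite !properE !sub0set !subsetT /=; split; apply/subsetPn.
  + by exists (Ordinal uN); rewrite inE //= uj u'j.
  + by exists (Ordinal vN); rewrite inE //= vj.
  + by exists (Ordinal vN); rewrite inE //= vj v'j.
  by exists (Ordinal uN); rewrite inE //= uj.
apply/biclique_cover_conflictP => // x y xy.
rewrite infeasible_SOS2 //; split=> [[j]|].
  rewrite mem_biclique !inE; move: xy; rewrite -val_eqE /= => xy xyj.
  (* Adjacent points share a code, whose bit [j] cannot take both values. *)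
  have [e|xy1] := eqVneq (val y) (val x).+1.
    by move: xyj; rewrite e; case: (tnth (h _.+1) j); rewrite ?(andbF, orbF).
  have [e|yx1] := eqVneq (val x) (val y).+1.
    by move: xyj; rewrite e; case: (tnth (h _.+1) j); rewrite ?(andbF, orbF).
  by move: xy xy1 yx1 => /=; lia.
by case/orP=> /gray_separated-/(_ (ltn_ord _))[j [[] [e1 e2 e3 e4]]];
  exists j; rewrite mem_biclique !inE e1 e2 e3 e4.
Qed.

End GrayCover.

(* [h i] is indexed by naturals as in h^{i,0}, ..., h^{i,d_i}; a grid point x
   has 1-based i-th coordinate x i + 1. [up_log 2 m] is the ceiling of log2 m
   for m >= 1. *)
Theorem corollary3 (eta : nat) (d : 'I_eta -> nat)
    (heta : 1 <= eta) (hd : forall i : 'I_eta, 2 <= d i) :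
  (forall (t : 'I_eta -> nat)
          (At Bt : forall i : 'I_eta, 'I_(t i) -> {set 'I_(d i)}),
     (forall i : 'I_eta,
        biclique_cover (conflict_graph (SOS2 (d i))) (t i) (At i) (Bt i)) ->
     biclique_cover (conflict_graph (grid_cells d)) (\sum_(i < eta) t i)
       (fun p : {i : 'I_eta & 'I_(t i)} =>
          [set x : grid d | x (tag p) \in At (tag p) (tagged p)])
       (fun p : {i : 'I_eta & 'I_(t i)} =>
          [set x : grid d | x (tag p) \in Bt (tag p) (tagged p)]))
  /\
  (forall h : forall i : 'I_eta, nat -> (up_log 2 (d i).-1).-tuple bool,
     (forall i : 'I_eta, gray_code [seq h i k | k <- iota 1 (d i).-1]) ->
     (forall i : 'I_eta, h i 0 = h i 1) ->
     (forall i : 'I_eta, h i (d i) = h i (d i).-1) ->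
     biclique_cover (conflict_graph (grid_cells d))
       (\sum_(i < eta) up_log 2 (d i).-1)
       (fun p : {i : 'I_eta & 'I_(up_log 2 (d i).-1)} =>
          [set x : grid d |
             (tnth (h (tag p) (x (tag p))) (tagged p) == false) &&
             (tnth (h (tag p) (x (tag p)).+1) (tagged p) == false)])
       (fun p : {i : 'I_eta & 'I_(up_log 2 (d i).-1)} =>
          [set x : grid d |
             (tnth (h (tag p) (x (tag p))) (tagged p) == true) &&
             (tnth (h (tag p) (x (tag p)).+1) (tagged p) == true)])).
Proof.
split; first exact: product_biclique_cover.
move=> h gray h0 hN.
have minL i : 0 < up_log 2 (d i).-1 -> 2 ^ (up_log 2 (d i).-1).-1 < (d i).-1.
  by rewrite up_log_gt0 => /(up_log_gtn (isT : 1 < 2)).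
have := product_biclique_cover _ _ hd _ _ _
  (fun i => gray_biclique_cover _ _ _ (hd i) (gray i) (minL i) (h0 i) (hN i)).
by apply: eq_biclique_cover => p; apply/setP=> x; rewrite !inE.
Qed.
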